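(* Let $A$ be an integer matrix with columns indexed by a finite set $\mathcal{I}$ of cells, and assume there is a vector $\mathbf{w}$ with $\mathbf{w}^\prime A=(1,\ldots,1)$. Assume the following condition (existence of a strong crossing pattern): for every fiber $\mathcal{F}_{\mathbf{t}}$ and all $\mathbf{x},\mathbf{y}\in\mathcal{F}_{\mathbf{t}}$ with $\mathbf{x}\neq\mathbf{y}$, there exist distinct cells $i_1,i_2,i_3,i_4\in\mathcal{I}$ such that either $$x(i_1)>y(i_1),\quad x(i_2)>y(i_2),\quad x(i_3)<y(i_3),\quad x(i_4)\le y(i_4),$$ or $$y(i_1)>x(i_1),\quad y(i_2)>x(i_2),\quad y(i_3)<x(i_3),\quad y(i_4)\le x(i_4),$$ and $\mathbf{z}=\mathbf{e}_{i_3}+\mathbf{e}_{i_4}-\mathbf{e}_{i_1}-\mathbf{e}_{i_2}$ is a move. Let $\mathcal{B}$ be the set of all moves of the form $\mathbf{e}_{i_3}+\mathbf{e}_{i_4}-\mathbf{e}_{i_1}-\mathbf{e}_{i_2}$ with $i_1,i_2,i_3,i_4$ distinct cells. Then $\mathcal{B}$ is distance reducing for tables with zero-one entries.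
   Context: For an integer matrix $A$ with columns indexed by a finite set $\mathcal{I}$, a (contingency) table is a vector $\mathbf{x}=(x(i))_{i\in\mathcal{I}}$ of nonnegative integers. The fiber of $\mathbf{t}$ is $\mathcal{F}_{\mathbf{t}}=\{\mathbf{x}\in\mathbb{Z}_{\ge0}^{\mathcal{I}} : A\mathbf{x}=\mathbf{t}\}$ and the zero-one fiber is $\tilde{\mathcal{F}}_{\mathbf{t}}=\{\mathbf{x}\in\{0,1\}^{\mathcal{I}} : A\mathbf{x}=\mathbf{t}\}$. A move is an integer vector $\mathbf{z}$ with $A\mathbf{z}=\mathbf{0}$. $\mathbf{e}_i$ is the table with $1$ in cell $i$ and $0$ elsewhere. $|\mathbf{z}|=\sum_i|z(i)|$. A finite set $\mathcal{B}$ of moves is distance reducing for tables with zero-one entries if for every $\mathbf{t}$ and all $\mathbf{x},\mathbf{y}\in\tilde{\mathcal{F}}_{\mathbf{t}}$ with $\mathbf{x}\ne\mathbf{y}$ there exist $\mathbf{z}\in\mathcal{B}$ and $\epsilon\in\{+1,-1\}$ such that either $\mathbf{x}+\epsilon\mathbf{z}\in\tilde{\mathcal{F}}_{\mathbf{t}}$ and $|\mathbf{x}+\epsilon\mathbf{z}-\mathbf{y}|<|\mathbf{x}-\mathbf{y}|$, or $\mathbf{y}+\epsilon\mathbf{z}\in\tilde{\mathcal{F}}_{\mathbf{t}}$ and $|\mathbf{x}-(\mathbf{y}+\epsilon\mathbf{z})|<|\mathbf{x}-\mathbf{y}|$. *)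

(* Defs.v *)
From mathcomp Require Import all_boot all_order all_algebra.
From mathcomp Require Import finmap.

Set Implicit Arguments.
Unset Strict Implicit.
Unset Printing Implicit Defensive.

Import Order.TTheory GRing.Theory Num.Theory.
Local Open Scope ring_scope.

(* An m-row integer matrix whose columns are indexed by I is given by its family
   of columns [A : I -> 'cV[int]_m]; integer vectors indexed by I, including
   tables, are elements of [{ffun I -> int}]. *)

Definition matvec (m : nat) (I : finType) (A : I -> 'cV[int]_m)
    (x : {ffun I -> int}) : 'cV[int]_m :=
  \sum_i x i *: A i.

(* The row w^T A is all ones.  Rational weights lose no generality over real
   ones: an integer linear system with a real solution has a rational one. *)
Definition homogeneous (m : nat) (I : finType) (A : I -> 'cV[int]_m) : Prop :=
  exists w : 'cV[rat]_m, forall i, w^T *m map_mx intr (A i) = 1%:M.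

Definition fiber (m : nat) (I : finType) (A : I -> 'cV[int]_m)
    (t : 'cV[int]_m) : pred {ffun I -> int} :=
  [pred x : {ffun I -> int} | [forall i, 0 <= x i] && (matvec A x == t)].

Definition fiber01 (m : nat) (I : finType) (A : I -> 'cV[int]_m)
    (t : 'cV[int]_m) : pred {ffun I -> int} :=
  [pred x : {ffun I -> int} |
    [forall i, (x i == 0) || (x i == 1)] && (matvec A x == t)].

Definition is_move (m : nat) (I : finType) (A : I -> 'cV[int]_m)
    (z : {ffun I -> int}) : bool :=
  matvec A z == 0.

Definition unit_table (I : finType) (i : I) : {ffun I -> int} :=
  [ffun j => (j == i)%:R].

Definition l1norm (I : finType) (z : {ffun I -> int}) : int := \sum_i `|z i|.

Definition cross (I : finType) (i1 i2 i3 i4 : I) : {ffun I -> int} :=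
  unit_table i3 + unit_table i4 - unit_table i1 - unit_table i2.

Definition has_strong_crossing_patterns (m : nat) (I : finType)
    (A : I -> 'cV[int]_m) : Prop :=
  forall (t : 'cV[int]_m) (x y : {ffun I -> int}),
    x \in fiber A t -> y \in fiber A t -> x <> y ->
  exists i1 i2 i3 i4 : I,
    [/\ uniq [:: i1; i2; i3; i4],
        [/\ x i1 > y i1, x i2 > y i2, x i3 < y i3 & x i4 <= y i4] \/
        [/\ y i1 > x i1, y i2 > x i2, y i3 < x i3 & y i4 <= x i4]
      & is_move A (cross i1 i2 i3 i4)].

Definition cross_moves (m : nat) (I : finType) (A : I -> 'cV[int]_m) :
    {fset {ffun I -> int}} :=
  [fset cross p.1.1 p.1.2 p.2.1 p.2.2
    | p in [pred p : (I * I) * (I * I) |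
             uniq [:: p.1.1; p.1.2; p.2.1; p.2.2] &&
             is_move A (cross p.1.1 p.1.2 p.2.1 p.2.2)]]%fset.

Definition distance_reducing01 (m : nat) (I : finType) (A : I -> 'cV[int]_m)
    (B : {fset {ffun I -> int}}) : Prop :=
  (forall z, z \in B -> is_move A z) /\
  forall (t : 'cV[int]_m) (x y : {ffun I -> int}),
    x \in fiber01 A t -> y \in fiber01 A t -> x <> y ->
  exists (z : {ffun I -> int}) (eps : int),
    [/\ z \in B, eps = 1 \/ eps = -1 &
        (x + z *~ eps \in fiber01 A t /\
         l1norm (x + z *~ eps - y) < l1norm (x - y)) \/
        (y + z *~ eps \in fiber01 A t /\
         l1norm (x - (y + z *~ eps)) < l1norm (x - y))].

(* Main.v *)
(* If x > y at i1 and i2, and x < y at i3, then adding the cross z to x - y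
   lowers the absolute value by one at each of these cells and raises it by at
   most one at i4, so it decreases the distance whatever happens at i4.  For
   zero-one tables, x i4 <= y i4 forces x i4 = 0, in which case x + z is
   zero-one, or y i4 = 1, in which case y - z is zero-one; either
   way the difference of the two tables becomes x - y + z. *)
Require Import Defs.
From mathcomp Require Import all_boot all_order all_algebra.
From mathcomp Require Import finmap.
From mathcomp Require Import zify.

Set Implicit Arguments.
Unset Strict Implicit.
Unset Printing Implicit Defensive.

Import Order.TTheory GRing.Theory Num.Theory.
Local Open Scope ring_scope.

(* Restating [ffunE] at type [int] makes [x i] syntactically uniform for [lia]. *)
Lemma tableD (I : finType) (x y : {ffun I -> int}) (i : I) :
  (x + y) i = x i + y i.
Proof. exact: ffunE. Qed.

Lemma tableB (I : finType) (x y : {ffun I -> int}) (i : I) :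
  (x - y) i = x i - y i.
Proof. by rewrite !ffunE. Qed.

Lemma matvecD (m : nat) (I : finType) (A : I -> 'cV[int]_m)
    (x y : {ffun I -> int}) : matvec A (x + y) = matvec A x + matvec A y.
Proof.
by rewrite /matvec -big_split; apply: eq_bigr => i _; rewrite ffunE scalerDl.
Qed.

Lemma matvecN (m : nat) (I : finType) (A : I -> 'cV[int]_m)
    (x : {ffun I -> int}) : matvec A (- x) = - matvec A x.
Proof. by rewrite /matvec -sumrN; apply: eq_bigr => i _; rewrite ffunE scaleNr. Qed.

Lemma l1norm_distC (I : finType) (x y : {ffun I -> int}) :
  l1norm (x - y) = l1norm (y - x).
Proof. by apply: eq_bigr => i _; rewrite !ffunE distrC. Qed.

Lemma crossE (I : finType) (i1 i2 i3 i4 j : I) :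
  cross i1 i2 i3 i4 j =
  (j == i3)%:R + (j == i4)%:R - (j == i1)%:R - (j == i2)%:R.
Proof. by rewrite !ffunE. Qed.

Lemma sum_indicator (I : finType) (i : I) : \sum_j (j == i)%:R = 1 :> int.
Proof. by rewrite (bigD1 i) //= eqxx big1 ?addr0 // => j /negPf ->. Qed.

(** A case on this specification substitutes the cell and fixes all four equality tests together, so
    the indicators in a cross become numerals and each case is linear arithmetic. *)
Variant eq4_spec (T : finType) (a b c d : T) :
    T -> bool -> bool -> bool -> bool -> Prop :=
  | Eq4First : eq4_spec a b c d a true false false false
  | Eq4Second : eq4_spec a b c d b false true false false
  | Eq4Third : eq4_spec a b c d c false false true false
  | Eq4Fourth : eq4_spec a b c d d false false false true
  | Eq4None x : eq4_spec a b c d x false false false false.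

Lemma eq4P (T : finType) (a b c d x : T) :
  uniq [:: a; b; c; d] ->
  eq4_spec a b c d x (x == a) (x == b) (x == c) (x == d).
Proof.
rewrite /= !inE !negb_or => /and4P[/and3P[ab ac ad] /andP[bc bd] cd _].
have [->|_] := eqVneq x a.
  by rewrite (negPf ab) (negPf ac) (negPf ad); constructor.
have [->|_] := eqVneq x b; first by rewrite (negPf bc) (negPf bd); constructor.
have [->|_] := eqVneq x c; first by rewrite (negPf cd); constructor.
by have [->|_] := eqVneq x d; constructor.
Qed.

Lemma fiber01P (m : nat) (I : finType) (A : I -> 'cV[int]_m) (t : 'cV[int]_m)
    (x : {ffun I -> int}) :
  reflect ((forall i, x i = 0 \/ x i = 1) /\ matvec A x = t) (x \in fiber01 A t).
Proof.
apply: (iffP andP) => [[/forallP x01 /eqP xt]|[x01 xt]]; split=> //.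
- by move=> i; case/orP: (x01 i) => /eqP; [left | right].
- by apply/forallP => i; case: (x01 i) => ->.
- exact/eqP.
Qed.

(** This lets the crossing hypothesis, stated for nonnegative tables, be used on zero-one tables. *)
Lemma fiber01_fiber (m : nat) (I : finType) (A : I -> 'cV[int]_m)
    (t : 'cV[int]_m) (x : {ffun I -> int}) :
  x \in fiber01 A t -> x \in fiber A t.
Proof.
case/fiber01P => x01 xt; rewrite inE xt eqxx andbT.
by apply/forallP => i; case: (x01 i) => ->.
Qed.

Lemma l1norm_add_cross_lt (I : finType) (d : {ffun I -> int}) (i1 i2 i3 i4 : I) :
  uniq [:: i1; i2; i3; i4] -> 0 < d i1 -> 0 < d i2 -> d i3 < 0 ->
  l1norm (d + cross i1 i2 i3 i4) < l1norm d.
Proof.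
move=> uniq_i d1 d2 d3.
have le_pt j : `|(d + cross i1 i2 i3 i4) j| <=
    `|d j| + ((j == i4)%:R - (j == i1)%:R - (j == i2)%:R - (j == i3)%:R).
  by rewrite tableD crossE; case: (eq4P j uniq_i) => *; lia.
apply: le_lt_trans (ler_sum _ (fun j _ => le_pt j)) _.
(* The pointwise corrections sum to 1 - 1 - 1 - 1 = -2, which is negative. *)
by rewrite big_split !sumrB !sum_indicator gtrDl.
Qed.

Lemma fiber01_add_cross (m : nat) (I : finType) (A : I -> 'cV[int]_m)
    (t : 'cV[int]_m) (x y : {ffun I -> int}) (i1 i2 i3 i4 : I) :
  x \in fiber01 A t -> y \in fiber01 A t ->
  uniq [:: i1; i2; i3; i4] -> is_move A (cross i1 i2 i3 i4) ->
  y i1 < x i1 -> y i2 < x i2 -> x i3 < y i3 -> x i4 <= y i4 ->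
  x + cross i1 i2 i3 i4 \in fiber01 A t \/ y - cross i1 i2 i3 i4 \in fiber01 A t.
Proof.
move=> /fiber01P[x01 xt] /fiber01P[y01 yt].
move=> uniq_i /eqP z0 xy1 xy2 xy3 xy4.
(* A strict inequality between zero-one entries fixes both of them. Hence adding the cross to [x],
   or subtracting it from [y], keeps the entries at [i1], [i2], [i3] zero-one, and only [i4] decides
   which table can be moved. *)
have [x1 y1] : x i1 = 1 /\ y i1 = 0 by move: (x01 i1) (y01 i1); lia.
have [x2 y2] : x i2 = 1 /\ y i2 = 0 by move: (x01 i2) (y01 i2); lia.
have [x3 y3] : x i3 = 0 /\ y i3 = 1 by move: (x01 i3) (y01 i3); lia.
have [x4|y4] : x i4 = 0 \/ y i4 = 1 by move: (x01 i4) (y01 i4); lia.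
- left; apply/fiber01P; split; last by rewrite matvecD z0 addr0.
  move=> j; rewrite tableD crossE; move: (x01 j).
  by case: (eq4P j uniq_i) => *; lia.
- right; apply/fiber01P; split; last by rewrite matvecD matvecN z0 subr0.
  move=> j; rewrite tableB crossE; move: (y01 j).
  by case: (eq4P j uniq_i) => *; lia.
Qed.

(** Only the orientation with [x] larger at [i1] and [i2] is treated; the opposite one follows by
    exchanging the two tables. *)
Lemma cross_distance_reducing (m : nat) (I : finType) (A : I -> 'cV[int]_m)
    (t : 'cV[int]_m) (x y : {ffun I -> int}) (i1 i2 i3 i4 : I) :
  x \in fiber01 A t -> y \in fiber01 A t ->
  uniq [:: i1; i2; i3; i4] -> is_move A (cross i1 i2 i3 i4) ->
  y i1 < x i1 -> y i2 < x i2 -> x i3 < y i3 -> x i4 <= y i4 ->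
  let z := cross i1 i2 i3 i4 in
  (x + z \in fiber01 A t /\ l1norm (x + z - y) < l1norm (x - y)) \/
  (y - z \in fiber01 A t /\ l1norm (x - (y - z)) < l1norm (x - y)).
Proof.
move=> xt yt uniq_i z_move xy1 xy2 xy3 xy4 z.
have lt_norm : l1norm (x - y + z) < l1norm (x - y).
  by apply: l1norm_add_cross_lt; rewrite // !tableB; lia.
rewrite addrAC; have -> : x - (y - z) = x - y + z by rewrite opprB addrA addrAC.
have [] := fiber01_add_cross xt yt uniq_i z_move xy1 xy2 xy3 xy4.
- by left.
- by right.
Qed.

Theorem theorem2p1 (m : nat) (I : finType) (A : I -> 'cV[int]_m)
    (hw : homogeneous A) (hA : has_strong_crossing_patterns A) :
  distance_reducing01 A (cross_moves A).
Proof.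
split=> [z /imfsetP[p /= /andP[_ z_move] ->] // | t x y xt yt neq_xy].
have [i1 [i2 [i3 [i4 [uniq_i pattern z_move]]]]] :=
  hA t x y (fiber01_fiber xt) (fiber01_fiber yt) neq_xy.
have zB : cross i1 i2 i3 i4 \in cross_moves A.
  apply/imfsetP; exists ((i1, i2), (i3, i4)) => //=.
  by apply/andP; split.
case: pattern => -[xy1 xy2 xy3 xy4].
- have [] := cross_distance_reducing xt yt uniq_i z_move
    xy1 xy2 xy3 xy4 => closer.
  + by exists (cross i1 i2 i3 i4), 1; split; [|left|left; rewrite mulr1z].
  + by exists (cross i1 i2 i3 i4), (-1); split; [|right|right; rewrite mulrN1z].
(* With the roles exchanged, the cross is added to [y] or subtracted from [x]. Symmetry of the
   distance restores the order of the tables on both sides of the inequality. *)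
- have [] := cross_distance_reducing yt xt uniq_i z_move
    xy1 xy2 xy3 xy4; rewrite l1norm_distC [ltRHS]l1norm_distC => closer.
  + by exists (cross i1 i2 i3 i4), 1; split; [|left|right; rewrite mulr1z].
  + by exists (cross i1 i2 i3 i4), (-1); split; [|right|left; rewrite mulrN1z].
Qed.
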